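(* Let $A=\begin{bmatrix} a & b & c\\ f & g & h\\ p & q & r\end{bmatrix}$ be a $3\times 3$ matrix with entries in the quaternions $\mathbb{H}$ such that $c\neq 0$, and let $\pi_A=g-hc^{-1}b$ be its pole. Suppose that $\pi_A$ is not a left eigenvalue of $A$, and let $B=A-\pi_A\,\mathrm{Id}$ (which is therefore invertible). Then the matrix $B^{-1}$ has a polynomial characteristic map.
   Context: A quaternion $\lambda$ is a left eigenvalue of a square quaternionic matrix $A$ if $A-\lambda\,\mathrm{Id}$ is not invertible. For an $n\times n$ quaternionic matrix $M=X+\mathbf{j}Y$ with $X,Y$ complex $n\times n$ matrices, Study's determinant is the non-negative real number $\mathrm{Sdet}(M)=(\det c(M))^{1/2}$, where $c(M)=\begin{bmatrix} X & -\overline{Y}\\ Y&\overline{X}\end{bmatrix}$ is a complex $2n\times 2n$ matrix. A map $\mu\colon\mathbb{H}\to\mathbb{H}$ is a characteristic map of the $n\times n$ quaternionic matrix $M$ if, up to a (positive) constant factor, $|\mu(\lambda)|=\mathrm{Sdet}(M-\lambda\,\mathrm{Id})$ for all $\lambda\in\mathbb{H}$. A map $\mathbb{H}\to\mathbb{H}$ is polynomial if it is a finite sum of monomials $\lambda\mapsto q_0\lambda q_1\lambda\cdots\lambda q_k$ with $k\ge 0$ and $q_0,\dots,q_k\in\mathbb{H}$. *)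

(* Defs.v *)
From HB Require Import structures.
From mathcomp Require Import all_boot all_order all_algebra.
From mathcomp Require Import complex ring.
From mathcomp Require Import reals.

Set Implicit Arguments.
Unset Strict Implicit.
Unset Printing Implicit Defensive.

Import Order.TTheory GRing.Theory Num.Theory.
Local Open Scope ring_scope.

(* [Quat x y] is the quaternion x + j y, where j ^ 2 = -1 and
   z j = j z^* for every complex number z. *)
Record quat (R : Type) : Type := Quat { qfst : R[i]; qsnd : R[i] }.

Section QuatRing.
Context {R : rcfType}.
Implicit Types p q : quat R.

Definition quat_pair q : R[i] * R[i] := (qfst q, qsnd q).
Definition pair_quat (z : R[i] * R[i]) : quat R := Quat z.1 z.2.

Lemma quat_pairK : cancel quat_pair pair_quat.
Proof. by case. Qed.

HB.instance Definition _ := Choice.copy (quat R) (can_type quat_pairK).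

Definition addq p q := Quat (qfst p + qfst q) (qsnd p + qsnd q).
Definition oppq q : quat R := Quat (- qfst q) (- qsnd q).

Lemma addqA : associative addq.
Proof. by move=> [? ?] [? ?] [? ?]; rewrite /addq /= !addrA. Qed.

Lemma addqC : commutative addq.
Proof. by move=> [x ?] [? ?]; congr Quat; rewrite addrC. Qed.

Lemma add0q : left_id (Quat 0 0) addq.
Proof. by move=> [? ?]; rewrite /addq /= !add0r. Qed.

Lemma addNq : left_inverse (Quat 0 0) oppq addq.
Proof. by move=> [? ?]; rewrite /addq /= !addNr. Qed.

HB.instance Definition _ := GRing.isZmodule.Build (quat R)
  addqA addqC add0q addNq.

(* (x1 + j y1) (x2 + j y2)
     = (x1 x2 - y1^* y2) + j (y1 x2 + x1^* y2) *)
Definition mulq p q := Quat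
  (qfst p * qfst q - (qsnd p)^* * qsnd q)
  (qsnd p * qfst q + (qfst p)^* * qsnd q).

Lemma mulqA : associative mulq.
Proof.
move=> [x1 y1] [x2 y2] [x3 y3]; rewrite /mulq /= rmorphB rmorphD !rmorphM /=.
by rewrite !conjCK; congr Quat; ring.
Qed.

Lemma mul1q : left_id (Quat 1 0) mulq.
Proof. by move=> [x y]; rewrite /mulq /= rmorph0 rmorph1; congr Quat; ring. Qed.

Lemma mulq1 : right_id (Quat 1 0) mulq.
Proof. by move=> [x y]; rewrite /mulq /=; congr Quat; ring. Qed.

Lemma qfstD p q : qfst (p + q) = qfst p + qfst q. Proof. by []. Qed.

Lemma qsndD p q : qsnd (p + q) = qsnd p + qsnd q. Proof. by []. Qed.

Lemma mulqDl : left_distributive mulq +%R.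
Proof.
move=> p q r; rewrite /mulq qfstD qsndD !rmorphD /=.
by rewrite [RHS]/(addq _ _) /addq /=; congr Quat; ring.
Qed.

Lemma mulqDr : right_distributive mulq +%R.
Proof.
move=> p q r; rewrite /mulq qfstD qsndD.
by rewrite [RHS]/(addq _ _) /addq /=; congr Quat; ring.
Qed.

Lemma oneq_neq0 : Quat 1 0 != 0 :> quat R.
Proof. by apply/eqP => -[] /eqP; rewrite oner_eq0. Qed.

HB.instance Definition _ := GRing.Zmodule_isNzRing.Build (quat R)
  mulqA mul1q mulq1 mulqDl mulqDr oneq_neq0.

Definition sqnormq q : R[i] := `|qfst q| ^+ 2 + `|qsnd q| ^+ 2.

Definition normq q : R[i] := sqrtC (sqnormq q).

Definition unitq : pred (quat R) := fun q => q != 0.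

(* The conjugate of x + j y is x^* - j y. *)
Definition invq q : quat R :=
  Quat ((qfst q)^* / sqnormq q) (- qsnd q / sqnormq q).

Lemma sqnormq_neq0 q : q != 0 -> sqnormq q != 0.
Proof.
case: q => x y; apply: contraNneq; rewrite /sqnormq /= => /eqP.
rewrite paddr_eq0 ?exprn_ge0 // !expf_eq0 /= !normr_eq0.
by case/andP=> /eqP-> /eqP->.
Qed.

Lemma conj_sqnormq q : (sqnormq q)^* = sqnormq q.
Proof. by apply/CrealP; rewrite /sqnormq rpredD ?rpredX ?normr_real. Qed.

Lemma sqnormq_div q : q != 0 ->
  (qfst q * (qfst q)^* + qsnd q * (qsnd q)^*) / sqnormq q = 1.
Proof. by move=> /sqnormq_neq0 n0; rewrite -!normCK divff. Qed.

Lemma mulVq : {in unitq, left_inverse 1 invq *%R}.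
Proof.
move=> q q0; rewrite [LHS]/(mulq _ _) /mulq /=.
rewrite !rmorphM fmorphV /= conj_sqnormq conjCK rmorphN /=; congr Quat.
  by rewrite -(sqnormq_div q0); ring.
ring.
Qed.

Lemma mulqV : {in unitq, right_inverse 1 invq *%R}.
Proof.
move=> q q0; rewrite [LHS]/(mulq _ _) /mulq /=; congr Quat.
  by rewrite -(sqnormq_div q0); ring.
ring.
Qed.

Lemma unitqP p q : q * p = 1 /\ p * q = 1 -> unitq p.
Proof.
case=> qp _; rewrite /unitq; apply/eqP => p0.
by move/eqP: qp; rewrite p0 mulr0 eq_sym oner_eq0.
Qed.

Lemma invq_out : {in [predC unitq], invq =1 id}.
Proof.
move=> q; rewrite inE /= /in_mem /= negbK => /eqP ->.
by rewrite /invq /= oppr0 !rmorph0 !mul0r.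
Qed.

HB.instance Definition _ := GRing.NzRing_hasMulInverse.Build (quat R)
  mulVq mulqV unitqP invq_out.

End QuatRing.

Section QuatMatrix.
Context {R : rcfType}.

(* [invmx] is only available over commutative rings. *)
Definition is_inverse_mx n (M N : 'M[quat R]_n) : Prop :=
  M *m N = 1%:M /\ N *m M = 1%:M.

Definition invertible_mx n (M : 'M[quat R]_n) : Prop :=
  exists N, is_inverse_mx M N.

Definition left_eigenvalue n (M : 'M[quat R]_n) (l : quat R) : Prop :=
  ~ invertible_mx (M - l%:M).

(* The complex form c(X + j Y). *)
Definition complex_mx n (M : 'M[quat R]_n) : 'M[R[i]]_(n + n) :=
  let X := map_mx (@qfst R) M in
  let Y := map_mx (@qsnd R) M in
  block_mx X (- map_mx Num.conj Y) Y (map_mx Num.conj X).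

(* The determinant is a non-negative real; like the norm on R[i], its root is
   left in R[i]. *)
Definition Sdet n (M : 'M[quat R]_n) : R[i] := sqrtC (\det (complex_mx M)).

Definition characteristic_map n (M : 'M[quat R]_n) (mu : quat R -> quat R) :
    Prop :=
  exists2 k : R, 0 < k & forall l, (k%:C)%C * normq (mu l) = Sdet (M - l%:M).

(* [monomial q0 [:: q1; ...; qk]] is l |-> q0 l q1 l ... l qk. *)
Definition monomial (q0 : quat R) (qs : seq (quat R)) (l : quat R) : quat R :=
  foldl (fun acc q => acc * l * q) q0 qs.

Definition polynomial_map (mu : quat R -> quat R) : Prop :=
  exists ms : seq (quat R * seq (quat R)),
    forall l, mu l = \sum_(m <- ms) monomial m.1 m.2 l.

(* Rows and columns are numbered from 0: this is g - h c^-1 b for the matrix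
   with rows (a, b, c), (f, g, h), (p, q, r). *)
Definition pole (A : 'M[quat R]_3) : quat R :=
  A 1 1 - A 1 2 * (A 0 2)^-1 * A 0 1.

End QuatMatrix.

(* Main.v *)
Require Import Defs.
From mathcomp Require Import all_boot all_order all_algebra.
From mathcomp Require Import complex.
From mathcomp Require Import boolp reals.

(** Put B = A - pi_A.  From B^-1 - l = B^-1 (1 - B l) and the multiplicativity
    of Sdet, the map l |-> Sdet (B^-1 - l) is a constant multiple of
    l |-> Sdet (1 - B l), so it is enough that the latter is the norm of a
    polynomial in l.  No inverse of l is ever taken.

    The pole of B is 0: with (a, b, c), (f, g, h), (p, q, r) now denoting the
    rows of B, this says that g = h c^-1 b.  Since c <> 0, subtracting
    h c^-1 times row 0 of 1 - B l from row 1, and r c^-1 times row 0 from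
    row 2, turns the entries of the last column below - c l into the constants
    0 and 1.  The vanishing of the pole is exactly what also turns the central
    entry into 1, and the result is
<<
      1 - a l   - b l   - c l
         u        1       0
         v        z       1
>>
    whose entries are polynomials in l.  The pivots of the lower right corner
    are the constant 1, so eliminating with them needs no division
    ([Sdet2_corner]): a single polynomial entry is left, and its norm is
    Sdet (1 - B l) ([Sdet2_char_map]).

    Determinants are handled through Sdet2 M = det c(M), the square of Sdet.
    The matrix c(M) interleaves the blocks of M badly, so block formulas for
    Sdet2 are not read off c(M).  They come instead from Sylvester's identity
    Sdet2 (1 + U V) = Sdet2 (1 + V U), inherited from complex matrices because
    c is a functor on rectangular matrices ([Sdet2_1D_mulC]).  That
    Sdet2 M >= 0 ([Sdet2_ge0]) makes its square root multiplicative and makes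
    Sdet B^-1 a positive real constant. *)

Local Open Scope ring_scope.

Set Implicit Arguments.
Unset Strict Implicit.
Unset Printing Implicit Defensive.

Import Order.TTheory GRing.Theory Num.Theory.

(** * Study's determinant *)

(** The product rule of pairs x + j y, for matrices of such pairs: conjugation
    is a ring morphism, so the right block column of the product is determined
    by the left one. *)
Lemma quat_block_mxM (C : numClosedFieldType) m n p
    (X1 Y1 : 'M[C]_(m, n)) (X2 Y2 : 'M[C]_(n, p)) :
  let conjm k l : 'M[C]_(k, l) -> 'M_(k, l) := map_mx Num.conj in
  let X := X1 *m X2 - conjm _ _ Y1 *m Y2 in
  let Y := Y1 *m X2 + conjm _ _ X1 *m Y2 in
  block_mx X (- conjm _ _ Y) Y (conjm _ _ X) =
  block_mx X1 (- conjm _ _ Y1) Y1 (conjm _ _ X1) *m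
  block_mx X2 (- conjm _ _ Y2) Y2 (conjm _ _ X2).
Proof.
move=> conjm X Y; rewrite /X /Y /conjm.
have conjmK k l (Z : 'M[C]_(k, l)) : map_mx Num.conj (map_mx Num.conj Z) = Z.
  by apply/matrixP => i j; rewrite !mxE conjCK.
rewrite mulmx_block map_mxB map_mxD !map_mxM /= !conjmK !mulmxN !mulNmx.
by congr block_mx; rewrite ?opprD // addrC.
Qed.

Lemma det_block11 (F : comPzRingType) (a b c d : 'M[F]_1) :
  \det (block_mx a b c d) = a 0 0 * d 0 0 - b 0 0 * c 0 0.
Proof.
have det2 (A : 'M[F]_(1 + 1)) : \det A =
    A (lshift 1 0) (lshift 1 0) * A (rshift 1 0) (rshift 1 0)
    - A (lshift 1 0) (rshift 1 0) * A (rshift 1 0) (lshift 1 0).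
  rewrite (expand_det_row _ (lshift 1 0)) big_ord_recl big_ord1 /cofactor.
  rewrite !det_mx11 !mxE /= expr0 expr1 !mulN1r mul1r mulrN.
  by congr (A _ _ * A _ _ - A _ _ * A _ _); exact: val_inj.
by rewrite det2 block_mxEul block_mxEdr block_mxEur block_mxEdl.
Qed.

(** Sylvester's identity: both sides are determinants of one matrix
    [[1, U], [- V, 1]], triangularized from above or from below. *)
Lemma det1D_mulC (F : comPzRingType) m n (U : 'M[F]_(m, n)) (V : 'M_(n, m)) :
  \det (1%:M + U *m V) = \det (1%:M + V *m U).
Proof.
have e1 : block_mx 1%:M (- U) 0 1%:M *m block_mx 1%:M U (- V) 1%:M =
    block_mx (1%:M + U *m V) 0 (- V) 1%:M.
  rewrite mulmx_block !(mul1mx, mulmx1, mul0mx, add0r) mulmxN mulNmx opprK.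
  by rewrite addrN.
have e2 : block_mx 1%:M 0 V 1%:M *m block_mx 1%:M U (- V) 1%:M =
    block_mx 1%:M U 0 (1%:M + V *m U).
  rewrite mulmx_block !(mul1mx, mulmx1, mul0mx, addr0) addrN.
  by rewrite [V *m U + _]addrC.
have := congr1 determinant e1; have := congr1 determinant e2.
by rewrite !det_mulmx !det_lblock !det_ublock !det1 !mul1r !mulr1 => -> ->.
Qed.

Section StudyDeterminant.
Context {R : rcfType}.
Local Notation H := (quat R).
Local Notation conjm := (map_mx Num.conj).

(** The form c(M), for rectangular matrices as well: Sylvester's identity
    needs c on both factors of a product U V that are not square. *)
Definition complex_form m n (M : 'M[H]_(m, n)) : 'M[R[i]]_(m + m, n + n) :=
  let X := map_mx (@qfst R) M in
  let Y := map_mx (@qsnd R) M in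
  block_mx X (- conjm Y) Y (conjm X).

(** Working with the square of Sdet avoids square roots until its
    positivity is available. *)
Definition Sdet2 m (M : 'M[H]_m) : R[i] := \det (complex_form M).

Lemma SdetE m (M : 'M[H]_m) : Sdet M = sqrtC (Sdet2 M).
Proof. by []. Qed.

Lemma qfst_sum I (r : seq I) (F : I -> H) :
  qfst (\sum_(i <- r) F i) = \sum_(i <- r) qfst (F i).
Proof. exact: (big_morph (@qfst R) (@qfstD R) (erefl _)). Qed.

Lemma qsnd_sum I (r : seq I) (F : I -> H) :
  qsnd (\sum_(i <- r) F i) = \sum_(i <- r) qsnd (F i).
Proof. exact: (big_morph (@qsnd R) (@qsndD R) (erefl _)). Qed.

Lemma complex_formM m n p (M : 'M[H]_(m, n)) (N : 'M[H]_(n, p)) :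
  complex_form (M *m N) = complex_form M *m complex_form N.
Proof.
have eX : map_mx (@qfst R) (M *m N) =
    map_mx (@qfst R) M *m map_mx (@qfst R) N
    - conjm (map_mx (@qsnd R) M) *m map_mx (@qsnd R) N.
  apply/matrixP => i j; rewrite !mxE qfst_sum -sumrB.
  by apply: eq_bigr => k _; rewrite !mxE.
have eY : map_mx (@qsnd R) (M *m N) =
    map_mx (@qsnd R) M *m map_mx (@qfst R) N
    + conjm (map_mx (@qfst R) M) *m map_mx (@qsnd R) N.
  apply/matrixP => i j; rewrite !mxE qsnd_sum -big_split.
  by apply: eq_bigr => k _; rewrite !mxE.
by rewrite /complex_form eX eY quat_block_mxM.
Qed.

Lemma complex_formD m n (M N : 'M[H]_(m, n)) :
  complex_form (M + N) = complex_form M + complex_form N.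
Proof.
rewrite /complex_form add_block_mx -opprD -!map_mxD.
by congr block_mx; [|congr (- _)| |]; apply/matrixP => i j; rewrite !mxE.
Qed.

Lemma complex_form1 n : complex_form (1%:M : 'M[H]_n) = 1%:M.
Proof.
have eX : map_mx (@qfst R) (1%:M : 'M[H]_n) = 1%:M.
  by apply/matrixP => i j; rewrite !mxE; case: (i == j).
have eY : map_mx (@qsnd R) (1%:M : 'M[H]_n) = 0.
  by apply/matrixP => i j; rewrite !mxE; case: (i == j).
by rewrite /complex_form eX eY map_mx0 map_mx1 oppr0 -scalar_mx_block.
Qed.

Lemma Sdet2M n (M N : 'M[H]_n) : Sdet2 (M *m N) = Sdet2 M * Sdet2 N.
Proof. by rewrite /Sdet2 complex_formM det_mulmx. Qed.

Lemma Sdet2_1 n : Sdet2 (1%:M : 'M[H]_n) = 1.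
Proof. by rewrite /Sdet2 complex_form1 det1. Qed.

(** The source of all block formulas: a matrix that differs from 1 in few rows
    or columns is 1 + U V with V U small. *)
Lemma Sdet2_1D_mulC m n (U : 'M[H]_(m, n)) (V : 'M_(n, m)) :
  Sdet2 (1%:M + U *m V) = Sdet2 (1%:M + V *m U).
Proof.
by rewrite /Sdet2 !complex_formD !complex_formM !complex_form1 det1D_mulC.
Qed.

Lemma Sdet2_block1 m n (S : 'M[H]_n) :
  Sdet2 (block_mx (1%:M : 'M_m) 0 0 S) = Sdet2 S.
Proof.
have -> : block_mx (1%:M : 'M_m) 0 0 S =
    1%:M + col_mx (0 : 'M_(m, n)) 1%:M *m row_mx 0 (S - 1%:M).
  rewrite mul_col_row !mul0mx !mul1mx (scalar_mx_block m n) add_block_mx.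
  by rewrite !addr0 addrC subrK.
by rewrite Sdet2_1D_mulC mul_row_col mul0mx mulmx1 add0r addrC subrK.
Qed.

Lemma Sdet2_ublock m n (P : 'M[H]_m) (Q : 'M_(m, n)) (S : 'M_n) :
  Sdet2 (block_mx P Q 0 S) = Sdet2 P * Sdet2 S.
Proof.
have -> : block_mx P Q 0 S =
    block_mx 1%:M 0 0 S *m (1%:M + col_mx 1%:M 0 *m row_mx (P - 1%:M) Q).
  rewrite mul_col_row !mul0mx !mul1mx (scalar_mx_block m n) add_block_mx.
  rewrite [1%:M + _]addrC subrK mulmx_block.
  by rewrite !(mul1mx, mulmx1, mul0mx, mulmx0, addr0, add0r).
rewrite Sdet2M Sdet2_block1 Sdet2_1D_mulC mul_row_col mulmx0 mulmx1 addr0 addrC.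
by rewrite subrK mulrC.
Qed.

Lemma Sdet2_lblock m n (P : 'M[H]_m) (V : 'M_(n, m)) (S : 'M_n) :
  Sdet2 (block_mx P 0 V S) = Sdet2 P * Sdet2 S.
Proof.
have -> : block_mx P 0 V S =
    (1%:M + col_mx (P - 1%:M) V *m row_mx 1%:M 0) *m block_mx 1%:M 0 0 S.
  rewrite mul_col_row !mulmx0 !mulmx1 (scalar_mx_block m n) add_block_mx.
  rewrite [1%:M + _]addrC subrK mulmx_block.
  by rewrite !(mul1mx, mulmx1, mul0mx, mulmx0, addr0, add0r).
rewrite Sdet2M Sdet2_block1 Sdet2_1D_mulC mul_row_col mul0mx mul1mx addr0 addrC.
by rewrite subrK.
Qed.

Lemma Sdet2_mx11 (M : 'M[H]_1) : Sdet2 M = sqnormq (M 0 0).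
Proof.
rewrite /Sdet2 det_block11 !mxE /sqnormq !normCK mulNr opprK.
by congr (_ + _); exact: mulrC.
Qed.

(** Over a noncommutative ring the left inverse of the pivot block is what
    clears the block below it by row operations. *)
Lemma Sdet2_Schur m n (P P' : 'M[H]_m) (Q : 'M_(m, n)) (V : 'M_(n, m))
    (S : 'M_n) : P' *m P = 1%:M ->
  Sdet2 (block_mx P Q V S) = Sdet2 P * Sdet2 (S - V *m P' *m Q).
Proof.
move=> P'P; rewrite -(Sdet2_ublock _ Q).
have <- : block_mx 1%:M 0 (- (V *m P')) 1%:M *m block_mx P Q V S =
    block_mx P Q 0 (S - V *m P' *m Q).
  rewrite mulmx_block !(mul1mx, mul0mx, addr0) !mulNmx -[_ *m P]mulmxA P'P.
  by rewrite mulmx1 addNr [- _ + S]addrC.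
by rewrite Sdet2M Sdet2_lblock !Sdet2_1 !mul1r.
Qed.

(** With pivot 1 the complement is polynomial in the entries: this is what
    keeps the characteristic map free of inverses. *)
Lemma Sdet2_Schur1 m n (P : 'M[H]_m) (Q : 'M_(m, n)) (V : 'M_(n, m)) :
  Sdet2 (block_mx P Q V 1%:M) = Sdet2 (P - Q *m V).
Proof.
have -> : block_mx P Q V 1%:M =
    block_mx (P - Q *m V) Q 0 1%:M *m block_mx 1%:M 0 V 1%:M.
  by rewrite mulmx_block !(mulmx1, mul1mx, mul0mx, mulmx0, add0r) subrK.
by rewrite Sdet2M Sdet2_lblock Sdet2_ublock !Sdet2_1 !mulr1.
Qed.

Lemma sqnormq_ge0 (q : H) : 0 <= sqnormq q.
Proof. by rewrite /sqnormq addr_ge0 ?exprn_ge0. Qed.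

(** Gaussian elimination: each nonzero pivot q contributes |q|^2.  A zero in
    the corner is replaced by a nonzero entry of its column by adding a row,
    and a zero column makes the determinant vanish. *)
Lemma Sdet2_ge0 n (M : 'M[H]_n) : 0 <= Sdet2 M.
Proof.
elim: n M => [|n IHn] M.
  by rewrite /Sdet2; move: (complex_form M) => N; rewrite det_mx00.
have pivot (N : 'M[H]_(1 + n)) : N 0 0 != 0 -> 0 <= Sdet2 N.
  move=> N00; rewrite -[N]submxK (@Sdet2_Schur _ _ _ (N 0 0)^-1%:M).
    by rewrite Sdet2_mx11 mulr_ge0 ?sqnormq_ge0.
  rewrite [ulsubmx N]mx11_scalar -scalar_mxM !mxE.
  by rewrite (_ : lshift n 0 = 0) ?mulVr //; exact: val_inj.
have [M00 | /pivot //] := eqVneq (M 0 0) 0.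
have [i Mi0 | col0] := pickP (fun i => M i 0 != 0).
  (* Adding row i to row 0 moves the entry M i 0 to the corner. *)
  have -> : Sdet2 M =
      Sdet2 ((1%:M + delta_mx 0 (0 : 'I_1) *m delta_mx 0 i) *m M).
    rewrite Sdet2M Sdet2_1D_mulC mul_delta_mx_cond.
    case: (i =P 0) Mi0 => [-> | _ _]; first by rewrite M00 eqxx.
    by rewrite mulr0n addr0 Sdet2_1 mul1r.
  apply: pivot; rewrite mulmxDl mul1mx mul_delta_mx mxE M00 add0r.
  rewrite mxE (bigD1 i) //= big1 ?addr0 => [|j ji].
    by rewrite !mxE !eqxx mul1r.
  by rewrite !mxE (negPf ji) andbF mul0r.
rewrite -(@submxK _ 1 n 1 n M).
have z k : M k 0 = 0 by apply/eqP; have /negbFE := col0 k.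
have -> : @ulsubmx _ 1 n 1 n M = 0.
  apply/matrixP => k j; rewrite !mxE [j]ord1 -[RHS](z (lshift n k)).
  by congr (M _ _); exact: val_inj.
have -> : @dlsubmx _ 1 n 1 n M = 0.
  apply/matrixP => k j; rewrite !mxE [j]ord1 -[RHS](z (rshift 1 k)).
  by congr (M _ _); exact: val_inj.
by rewrite (@Sdet2_ublock 1 n) Sdet2_mx11 mulr_ge0 ?sqnormq_ge0.
Qed.

End StudyDeterminant.

(** * Polynomial maps form a ring *)

Section PolynomialMaps.
Context {R : rcfType}.
Local Notation H := (quat R).
Implicit Types (q : H) (P Q : H -> H).

(** Monomials are folded from the right end; this peels them from the left,
    where multiplying by a polynomial map is easy. *)
Lemma monomial_cons (q r l : H) rs :
  monomial q (r :: rs) l = q * l * monomial r rs l.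
Proof.
rewrite /= /monomial /=; elim/last_ind: rs => [|rs s IH] //=.
by rewrite !foldl_rcons IH !mulrA.
Qed.

Lemma polynomial_ext P Q : P =1 Q -> polynomial_map P -> polynomial_map Q.
Proof. by move=> PQ [ms Pms]; exists ms => l; rewrite -PQ. Qed.

Lemma polynomial_const q : polynomial_map (fun=> q).
Proof. by exists [:: (q, [::])] => l; rewrite big_seq1. Qed.

Lemma polynomialD P Q :
  polynomial_map P -> polynomial_map Q -> polynomial_map (fun l => P l + Q l).
Proof.
by move=> [ms Pms] [ns Qns]; exists (ms ++ ns) => l; rewrite big_cat Pms Qns.
Qed.

Lemma polynomial_constM q P :
  polynomial_map P -> polynomial_map (fun l => q * P l).
Proof.
move=> [ms Pms]; exists [seq (q * m.1, m.2) | m <- ms] => l.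
rewrite Pms big_map mulr_sumr; apply: eq_bigr => -[r rs] _ /=.
rewrite /monomial; elim/last_ind: rs => [|rs s IH] //=.
by rewrite !foldl_rcons !mulrA IH.
Qed.

Lemma polynomialB P Q :
  polynomial_map P -> polynomial_map Q -> polynomial_map (fun l => P l - Q l).
Proof.
move=> polyP /(polynomial_constM (-1)) polyQ.
by apply: polynomial_ext (polynomialD polyP polyQ) => l; rewrite mulN1r.
Qed.

Lemma polynomial_varM q P :
  polynomial_map P -> polynomial_map (fun l => q * l * P l).
Proof.
move=> [ms Pms]; exists [seq (q, m.1 :: m.2) | m <- ms] => l.
rewrite Pms big_map mulr_sumr; apply: eq_bigr => -[r rs] _.
by rewrite monomial_cons.
Qed.

(** Multiplying on the left by a monomial is a succession of multiplications
    by a constant q and by q l, by [polynomial_constM] and [polynomial_varM]. *)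
Lemma polynomialM P Q :
  polynomial_map P -> polynomial_map Q -> polynomial_map (fun l => P l * Q l).
Proof.
move=> [ms Pms] polyQ.
apply: (@polynomial_ext (fun l => (\sum_(m <- ms) monomial m.1 m.2 l) * Q l)).
  by move=> l; rewrite Pms.
elim: ms {P Pms} => [|[q qs] ms IH].
  apply: (@polynomial_ext (fun=> 0)); last exact: polynomial_const.
  by move=> l; rewrite big_nil mul0r.
apply: (@polynomial_ext (fun l => monomial q qs l * Q l +
  (\sum_(m <- ms) monomial m.1 m.2 l) * Q l)).
  by move=> l; rewrite big_cons mulrDl.
apply: polynomialD IH.
elim: qs q => [|r rs IH] q; first exact: polynomial_constM.
apply: (@polynomial_ext (fun l => q * l * (monomial r rs l * Q l))).
  by move=> l; rewrite monomial_cons mulrA.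
exact: polynomial_varM.
Qed.

End PolynomialMaps.

(** * Three by three matrices with pole zero *)

Section ThreeByThree.
Context {R : rcfType}.
Local Notation H := (quat R).

(** Two eliminations from the bottom right, with the pivots N 2 2 = 1 and then
    N 1 1 = 1; N 1 2 = 0 ensures that the first leaves row 1, and hence the
    second pivot, unchanged. *)
Lemma Sdet2_corner (N : 'M[H]_3) :
  N 1 1 = 1 -> N 1 2 = 0 -> N 2 2 = 1 ->
  Sdet2 N =
  sqnormq (N 0 0 - N 0 2 * N 2 0 - (N 0 1 - N 0 2 * N 2 1) * N 1 0).
Proof.
move=> N11 N12 N22; rewrite -[in LHS](@submxK _ 2 1 2 1 N).
have -> : @drsubmx _ 2 1 2 1 N = 1%:M.
  rewrite [LHS]mx11_scalar !mxE -N22; congr (N _ _)%:M; exact: val_inj.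
rewrite (@Sdet2_Schur1 _ 2 1); set S := _ - _.
have SE (i j : 'I_2) (k l : 'I_3) : val i = val k -> val j = val l ->
    S i j = N k l - N k 2 * N 2 l.
  move=> ik jl; rewrite !mxE big_ord1 !mxE.
  by congr (N _ _ - N _ _ * N _ _); exact: val_inj.
rewrite -(@submxK _ 1 1 1 1 S).
have -> : @drsubmx _ 1 1 1 1 S = 1%:M.
  rewrite [LHS]mx11_scalar [in LHS]mxE [in LHS]mxE (SE _ _ 1 1) //.
  by rewrite N11 N12 mul0r subr0.
rewrite (@Sdet2_Schur1 _ 1 1) Sdet2_mx11; congr sqnormq.
rewrite [LHS]mxE [X in _ + X]mxE [X in _ - X]mxE big_ord1.
rewrite [ulsubmx _ _ _]mxE [usubmx _ _ _]mxE.
rewrite [ursubmx _ _ _]mxE [usubmx _ _ _]mxE.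
rewrite [dlsubmx _ _ _]mxE [dsubmx _ _ _]mxE.
rewrite (SE _ _ 0 0) // (SE _ _ 0 1) // (SE _ _ 1 0) //.
by rewrite N12 mul0r subr0.
Qed.

(** The multiple of row 0 that clears the variable from the entry (i, 2) of
    1 - B l.  The coefficient 0 leaves row 0 in place, so that the row
    operation has determinant 1. *)
Definition elim_coef (B : 'M[H]_3) (i : 'I_3) : H :=
  if i == 0 then 0 else B i 2 / B 0 2.

(** An entry of 1 - B l after this row operation, as a function of l last, so
    that for each i and j it is a polynomial map. *)
Definition elim_entry (B : 'M[H]_3) (i j : 'I_3) (l : H) : H :=
  ((i == j)%:R - B i j * l) - elim_coef B i * ((0 == j)%:R - B 0 j * l).

(** The value given by [Sdet2_corner] on those entries. *)
Definition char_map (B : 'M[H]_3) (l : H) : H :=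
  let N i j := elim_entry B i j l in
  N 0 0 - N 0 2 * N 2 0 - (N 0 1 - N 0 2 * N 2 1) * N 1 0.

(** The hypotheses say that B has a pole and that it vanishes; the row
    operation then brings 1 - B l to the shape required by [Sdet2_corner]. *)
Lemma Sdet2_char_map (B : 'M[H]_3) (l : H) :
    B 0 2 != 0 -> B 1 1 = B 1 2 / B 0 2 * B 0 1 ->
  Sdet2 (1%:M - B *m l%:M) = sqnormq (char_map B l).
Proof.
move=> c0 g0.
(* The row operation is E = 1 - k e_0, and e_0 k = 0. *)
pose k : 'cV_3 := \col_i elim_coef B i.
pose E : 'M_3 := 1%:M + k *m (- delta_mx (0 : 'I_1) 0).
have E1 : Sdet2 E = 1.
  rewrite /E Sdet2_1D_mulC mulNmx -rowE.
  suff -> : row 0 k = 0 by rewrite oppr0 addr0 Sdet2_1.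
  by apply/matrixP => i j; rewrite !mxE.
have ME i j : (1%:M - B *m l%:M) i j = (i == j)%:R - B i j * l.
  rewrite !mxE (bigD1 j) //= mxE eqxx big1 ?addr0 // => k' k'j.
  by rewrite mxE (negPf k'j) mulr0.
have NE i j : (E *m (1%:M - B *m l%:M)) i j = elim_entry B i j l.
  rewrite mulmxDl mul1mx -mulmxA mulNmx -rowE mulmxN.
  rewrite mxE [X in _ + X]mxE [X in _ - X]mxE big_ord1 [row _ _ _ _]mxE.
  by rewrite !ME mxE.
rewrite -[LHS]mul1r -E1 -Sdet2M Sdet2_corner ?NE //.
- rewrite /elim_entry /elim_coef /= g0 sub0r mulrN opprK !mulrA.
  by rewrite subrK.
- by rewrite /elim_entry /elim_coef /= !sub0r mulrN opprK mulrA divrK ?addNr.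
by rewrite /elim_entry /elim_coef /= sub0r mulrN opprK mulrA divrK ?subrK.
Qed.

Lemma polynomial_char_map (B : 'M[H]_3) : polynomial_map (char_map B).
Proof.
have polyE i j : polynomial_map (elim_entry B i j).
  have lin q r : polynomial_map (fun l : H => q - r * l).
    apply: polynomialB; first exact: polynomial_const.
    apply: polynomial_ext (polynomial_varM r (polynomial_const 1)) => l.
    by rewrite mulr1.
  by apply: polynomialB => //; apply: polynomial_constM.
apply: (@polynomialB _ (fun l => _ - _ * _) (fun l => (_ - _ * _) * _)).
  by apply: polynomialB => //; apply: polynomialM.
apply: polynomialM => //; apply: polynomialB => //.
exact: polynomialM.
Qed.

End ThreeByThree.

Theorem theorem43 (R : realType) (A : 'M[quat R]_3)
    (c_neq0 : A 0 2 != 0)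
    (pole_not_eigen : ~ left_eigenvalue A (pole A)) :
  exists2 Binv : 'M[quat R]_3,
    is_inverse_mx (A - (pole A)%:M) Binv &
    exists2 mu : quat R -> quat R,
      polynomial_map mu & characteristic_map Binv mu.
Proof.
have [Binv [BBinv BinvB]] := contrapT pole_not_eigen.
exists Binv; first by split.
set B := A - _ in BBinv BinvB.
exists (char_map B); first exact: polynomial_char_map.
have c0 : B 0 2 != 0 by rewrite !mxE subr0.
have g0 : B 1 1 = B 1 2 / B 0 2 * B 0 1.
  by rewrite !mxE !subr0 /pole subKr.
have Binv_gt0 : 0 < sqrtC (Sdet2 Binv).
  rewrite sqrtC_gt0 lt_def Sdet2_ge0 andbT; apply/eqP => Binv0.
  move: (congr1 (@Sdet2 R 3) BBinv); rewrite Sdet2M Binv0 mulr0 Sdet2_1.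
  by move/eqP; rewrite eq_sym oner_eq0.
have Binv_re : (complex.Re (sqrtC (Sdet2 Binv)))%:C%C = sqrtC (Sdet2 Binv).
  exact/RRe_real/gtr0_real.
exists (complex.Re (sqrtC (Sdet2 Binv))); first by rewrite -ltcR Binv_re.
move=> l; rewrite Binv_re SdetE.
have -> : Binv - l%:M = Binv *m (1%:M - B *m l%:M).
  by rewrite mulmxBr mulmx1 mulmxA BinvB mul1mx.
by rewrite Sdet2M sqrtCM ?nnegrE ?Sdet2_ge0 // (Sdet2_char_map _ c0 g0).
Qed.
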